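(* Let $f:\mathbb{R}^d\to\mathbb{R}$ be convex and $L$-smooth (i.e. differentiable with $L$-Lipschitz gradient), with a minimizer $\theta^*$, and let $\hat L\ge L$ and $\gamma_0>0$. Consider the following idealized (P)ARS-OPT iteration, started from $\theta_0\in\mathbb{R}^d$ with $m_0=\theta_0$. At each iteration $t=0,1,\dots,T-1$: (i) a scalar $\zeta_t>0$ is chosen that is measurable with respect to $\mathcal{F}_t$, the $\sigma$-algebra generated by all randomness used before iteration $t$; (ii) $\alpha_t\in(0,1)$ is the positive root of $\alpha_t^2=\zeta_t\gamma_t(1-\alpha_t)$, $\tilde\theta_t=(1-\alpha_t)\theta_t+\alpha_t m_t$, and $\gamma_{t+1}=(1-\alpha_t)\gamma_t$; (iii) a random orthonormal family $\mathbf{v}_t,\mathbf{p}_{t,1},\dots,\mathbf{p}_{t,s}$ ($s\ge 0$) is drawn, and $g_1(\tilde\theta_t)=\nabla f(\tilde\theta_t)^\top\mathbf{v}_t\,\mathbf{v}_t+\sum_{i=1}^s\nabla f(\tilde\theta_t)^\top\mathbf{p}_{t,i}\,\mathbf{p}_{t,i}$ (the orthogonal projection of $\nabla f(\tilde\theta_t)$ onto the span of this family), while $g_2(\tilde\theta_t)$ is a random vector satisfying $\mathbb{E}_t[g_2(\tilde\theta_t)]=\nabla f(\tilde\theta_t)$, where $\mathbb{E}_t$ denotes conditional expectation given $\mathcal{F}_t$; (iv) the step size satisfies $\zeta_t\le \dfrac{\mathbb{E}_t\big[\|g_1(\tilde\theta_t)\|^2\big]}{\hat L\,\mathbb{E}_t\big[\|g_2(\tilde\theta_t)\|^2\big]}$;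 (v) $\theta_{t+1}=\tilde\theta_t-\frac{1}{\hat L}g_1(\tilde\theta_t)$ and $m_{t+1}=m_t-\frac{\zeta_t}{\alpha_t}g_2(\tilde\theta_t)$. Then $$\mathbb{E}\left[\big(f(\theta_T)-f(\theta^* )\big)\left(1+\frac{\sqrt{\gamma_0}}{2}\sum_{t=0}^{T-1}\sqrt{\zeta_t}\right)^2\right]\le f(\theta_0)-f(\theta^* )+\frac{\gamma_0}{2}\|\theta_0-\theta^*\|^2.$$
   Context: In the ARS-OPT case $s=0$ and $g_1(\tilde\theta_t)=\nabla f(\tilde\theta_t)^\top\mathbf{v}_t\,\mathbf{v}_t$ with $\mathbf{v}_t$ a unit vector. $\|\cdot\|$ is the Euclidean norm. *)

(* Defs.v *)
From HB Require Import structures.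
From mathcomp Require Import all_boot all_order all_algebra.
From mathcomp Require Import all_classical all_reals all_analysis measurable_realfun.
Set Implicit Arguments. Unset Strict Implicit. Unset Printing Implicit Defensive.
Import Order.TTheory GRing.Theory Num.Theory.
Import numFieldNormedType.Exports.
Local Open Scope classical_set_scope.
Local Open Scope ring_scope.

Section Defs.
Context {R : realType}.

Definition dotv {d : nat} (u v : 'rV[R]_d) : R := \sum_(i < d) u 0 i * v 0 i.
Definition norm2 {d : nat} (u : 'rV[R]_d) : R := Num.sqrt (dotv u u).

Definition grad {d : nat} (f : 'rV[R]_d -> R) (x : 'rV[R]_d) : 'rV[R]_d :=
  \row_(i < d) ('d f x (delta_mx 0 i : 'rV[R]_d)).

Definition convex_fun {d : nat} (f : 'rV[R]_d -> R) : Prop :=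
  forall (x y : 'rV[R]_d) (a : R), 0 <= a <= 1 ->
    f ((1 - a) *: x + a *: y) <= (1 - a) * f x + a * f y.

Definition L_smooth {d : nat} (L : R) (f : 'rV[R]_d -> R) : Prop :=
  (forall x, differentiable f x) /\
  (forall x y, norm2 (grad f x - grad f y) <= L * norm2 (x - y)).

Context {dT : measure_display} {T : measurableType dT}.

Definition meas_wrt (G : set (set T)) (X : T -> R) : Prop :=
  forall B : set R, measurable B -> G (X @^-1` B).
Definition emeas_wrt (G : set (set T)) (X : T -> \bar R) : Prop :=
  forall B : set (\bar R), measurable B -> G (X @^-1` B).
Definition vmeas_wrt {d : nat} (G : set (set T)) (X : T -> 'rV[R]_d) : Prop :=
  forall i : 'I_d, meas_wrt G (fun w => X w 0 i).

Definition filtration (F : nat -> set (set T)) : Prop :=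
  forall t, sigma_algebra setT (F t) /\ F t `<=` measurable /\ F t `<=` F t.+1.

Definition is_cond_exp (P : probability T R) (G : set (set T)) (X Y : T -> R) : Prop :=
  P.-integrable setT (fun w => (X w)%:E) /\
  meas_wrt G Y /\ P.-integrable setT (fun w => (Y w)%:E) /\
  forall A, G A -> (\int[P]_(w in A) (X w)%:E = \int[P]_(w in A) (Y w)%:E)%E.

Definition is_cond_exp_nonneg (P : probability T R) (G : set (set T)) (X : T -> R)
    (Y : T -> \bar R) : Prop :=
  (forall w, 0 <= X w) /\ measurable_fun setT X /\
  emeas_wrt G Y /\ (forall w, (0 <= Y w)%E) /\
  forall A, G A -> (\int[P]_(w in A) (X w)%:E = \int[P]_(w in A) Y w)%E.

End Defs.

(* Main.v *)
Require Import Defs.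
From HB Require Import structures.
From mathcomp Require Import all_boot all_order all_algebra.
From mathcomp Require Import all_classical all_reals all_analysis measurable_realfun.
From mathcomp Require Import ring lra.
Import Order.TTheory GRing.Theory Num.Theory.
Import numFieldNormedType.Exports HBNNSimple.
Local Open Scope classical_set_scope.
Local Open Scope ring_scope.
Set Implicit Arguments. Unset Strict Implicit. Unset Printing Implicit Defensive.

(** The potential [W_t = gamma0 / gamma_t * (f theta_t - f theta_star)
    + gamma0 / 2 * |m_t - theta_star|^2] has nonincreasing expectation: smoothness
    gives a decrease of [|g1|^2 / (2 Lhat)], which by the step size condition
    pays in conditional expectation for the term [|g2|^2] produced by expanding
    [|m_{t+1} - theta_star|^2], while the cross term is absorbed by convexity at
    [thtil_t].  Since [alpha_t^2 = zeta_t gamma_{t+1}], the quantity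
    [1 / sqrt gamma_t] grows by at least [sqrt zeta_t / 2] at each iteration, so
    [W_T] dominates the integrand of the theorem.  As no integrability of
    [theta_t] and [m_t] is assumed, conditional expectations are only taken on
    [F_t]-measurable events on which the [F_t]-measurable factors are bounded. *)

(** * Pulling measurable factors out of conditional expectations of nonnegative functions *)

Section condexp.
Context {R : realType} {dT : measure_display} {T : measurableType dT}.
Variable P : {measure set T -> \bar R}.
Implicit Types (G : set (set T)) (A : set T).

(** Recasts [meas_wrt] as measurability on the space equipped with [G] itself, so that the closure
    properties of measurable functions apply to it. *)
Lemma meas_wrtP G (X : T -> R) : sigma_algebra setT G ->
  meas_wrt G X <-> measurable_fun (setT : set (g_sigma_algebraType G)) X.
Proof.
move=> sG; split => [mX _ B mB|mX B mB].
  by rewrite setTI /measurable/= sigma_algebra_id//; exact: mX.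
have := mX measurableT B mB.
by rewrite setTI /measurable/= sigma_algebra_id.
Qed.

(** For the indicator of an event of [G] in place of [h] this is the hypothesis; linearity extends
    it to simple functions, and monotone convergence along an increasing approximation of [h] gives
    the general case. Nonnegativity allows both sides to be infinite. *)
Lemma integral_pullout G (X Y : T -> \bar R) (h : T -> R) :
  sigma_algebra setT G -> G `<=` measurable ->
  measurable_fun setT X -> measurable_fun setT Y ->
  (forall w, 0 <= X w)%E -> (forall w, 0 <= Y w)%E ->
  (forall A, G A -> (\int[P]_(w in A) X w = \int[P]_(w in A) Y w)%E) ->
  meas_wrt G h -> (forall w, 0 <= h w) ->
  (\int[P]_w ((h w)%:E * X w) = \int[P]_w ((h w)%:E * Y w))%E.
Proof.
move=> sG Gm mX mY X0 Y0 XY /(meas_wrtP _ sG) mh h0.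
pose GT := g_sigma_algebraType G.
have mGT (A : set T) : measurable (A : set GT) -> measurable A.
  by rewrite {1}/measurable/= sigma_algebra_id//; exact: Gm.
have mhE : measurable_fun (setT : set GT) (EFin \o h) by exact/measurable_EFinP.
pose gs : {nnsfun GT >-> R}^nat := nnsfun_approx (@measurableT _ GT) mhE.
pose g n : T -> R := gs n.
have fing n : finite_set (range (g n)) by exact: (@fimfunP _ _ (gs n)).
have mg n : measurable_fun (setT : set T) (g n).
  move=> _ B mB; rewrite setTI.
  have := @measurable_funPT _ _ _ _ (gs n) measurableT B mB.
  by rewrite setTI => /mGT.
have simple n (Z : T -> \bar R) : measurable_fun setT Z -> (forall w, 0 <= Z w)%E ->
    (\int[P]_w ((g n w)%:E * Z w) =
     (\sum_(y \in range (g n)) (y%:E * \int[P]_(w in g n @^-1` [set y]) Z w)%E)%R)%E.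
  move=> mZ Z0.
  (* The integrand is split along the level sets of [g n]: at [w] only the summand [y = g n w]
     survives. *)
  transitivity (\int[P]_w (\sum_(y \in range (g n))
      (y%:E * (Z \_ (g n @^-1` [set y])) w)%E)%R)%E.
    apply: eq_integral => w _.
    rewrite (fsbigD1 (g n w) _ _ (fing n))/=; last by exists w.
    rewrite patchE ifT ?inE// fsbig1 ?adde0// => y [_ yg] /=.
    rewrite patchE ifF ?mule0//; apply/negbTE; rewrite notin_setE/= => gy.
    by apply: yg; rewrite gy.
  have mp y : measurable (g n @^-1` [set y] : set T).
    by rewrite -[X in measurable X]setTI; apply: mg.
  rewrite ge0_integral_fsum//; last 2 first.
  - move=> y; apply: emeasurable_funM => //.
    by apply/(measurable_restrictT _ (mp y)); exact: measurable_funTS.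
  - move=> y w _.
    (* A negative [y] has an empty level set because [g n] is nonnegative. *)
    case: (ltP y 0) => [y0|y0]; last by rewrite mule_ge0 ?lee_fin// erestrict_ge0.
    rewrite patchE; case: ifPn; rewrite ?mule0// inE/= => gy.
    by move: y0; rewrite -gy ltNge fun_ge0.
  apply: eq_fsbigr => y; rewrite inE => -[w0 _ <-].
  rewrite ge0_integralZl//.
  - by rewrite -integral_mkcond.
  - by apply/(measurable_restrictT _ (mp _)); exact: measurable_funTS.
  - by move=> w _; exact: erestrict_ge0.
  - by rewrite lee_fin.
have lim (Z : T -> \bar R) : measurable_fun setT Z -> (forall w, 0 <= Z w)%E ->
    ((\int[P]_w ((g n w)%:E * Z w)) @[n --> \oo] --> \int[P]_w ((h w)%:E * Z w))%E.
  move=> mZ Z0.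
  have -> : (\int[P]_w ((h w)%:E * Z w) = \int[P]_w (limn (fun n => (g n w)%:E * Z w)))%E.
    apply: eq_integral => w _; apply/esym/cvg_lim => //.
    have gh : (EFin \o (g ^~ w)) @ \oo --> (h w)%:E.
      by apply: (cvg_nnsfun_approx (@measurableT _ GT) mhE) => // x _; rewrite lee_fin.
    (* The product of the limits is problematic only as zero times infinity; where [h w = 0] the
       nonnegative approximations increase to 0, hence all vanish. *)
    have [h_0|h_gt0] := eqVneq (h w) 0; last first.
      by apply: cvgeM gh (cvg_cst _); rewrite /mule_def; case: (Z w).
    have g_0 n : g n w = 0.
      have ndg : nondecreasing_seq (g ^~ w).
        move=> a b ab.
        have /(_ a b ab)/lefP/(_ w) := nd_nnsfun_approx (@measurableT _ GT) mhE; exact.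
      have ghR : g ^~ w @ \oo --> h w by exact: (fine_cvg gh).
      apply/eqP; rewrite eq_le fun_ge0 andbT -h_0 -(cvg_lim _ ghR)//.
      by apply: nondecreasing_cvgn_le => //; apply/cvg_ex; exists (h w).
    by under eq_fun do rewrite g_0 mul0e; rewrite h_0 mul0e; exact: cvg_cst.
  apply: cvg_monotone_convergence => //.
  - move=> n; apply: emeasurable_funM => //; exact/measurable_EFinP.
  - by move=> n w _; rewrite mule_ge0// lee_fin.
  - move=> w _ a b ab; rewrite lee_wpmul2r// lee_fin.
    have /(_ a b ab)/lefP/(_ w) := nd_nnsfun_approx (@measurableT _ GT) mhE; exact.
apply: (cvg_unique _ (lim X mX X0)) => //.
have -> : (fun n => \int[P]_w ((g n w)%:E * X w))%E = (fun n => \int[P]_w ((g n w)%:E * Y w))%E.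
  apply/funext => n; rewrite !simple//; apply: eq_fsbigr => y _; congr (_ * _)%E.
  (* The level sets of [g n] belong to [G], since [g n] is simple on the space equipped with [G]. *)
  apply: XY.
  have := @measurable_funPT _ _ _ _ (gs n) measurableT _ (measurable_set1 y).
  by rewrite setTI {1}/measurable/= sigma_algebra_id.
exact: lim.
Qed.

Lemma meas_wrt_measurable G (X : T -> R) : G `<=` measurable ->
  meas_wrt G X -> measurable_fun setT X.
Proof. by move=> Gm mX _ B mB; rewrite setTI; exact/Gm/mX. Qed.

Lemma emeas_wrt_measurable G (X : T -> \bar R) : G `<=` measurable ->
  emeas_wrt G X -> measurable_fun setT X.
Proof. by move=> Gm mX _ B mB; rewrite setTI; exact/Gm/mX. Qed.

(** The restriction to [A] is absorbed into the factor: [h] times the indicator of [A] is again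
    nonnegative and [G]-measurable. *)
Lemma integral_pullout_on G (X Y : T -> \bar R) (h : T -> R) A :
  sigma_algebra setT G -> G `<=` measurable ->
  measurable_fun setT X -> measurable_fun setT Y ->
  (forall w, 0 <= X w)%E -> (forall w, 0 <= Y w)%E ->
  (forall A, G A -> (\int[P]_(w in A) X w = \int[P]_(w in A) Y w)%E) ->
  meas_wrt G h -> (forall w, 0 <= h w) -> G A ->
  (\int[P]_(w in A) ((h w)%:E * X w) = \int[P]_(w in A) ((h w)%:E * Y w))%E.
Proof.
move=> sG Gm mX mY X0 Y0 XY mh h0 GA.
have restrictE (Z : T -> \bar R) : (\int[P]_(w in A) ((h w)%:E * Z w) =
    \int[P]_w ((h w * \1_A w)%:E * Z w))%E.
  rewrite integral_mkcond; apply: eq_integral => w _.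
  by rewrite patchE indicE; case: (w \in A); rewrite ?mulr1// mulr0 mul0e.
rewrite !restrictE; apply: (@integral_pullout G) => //.
  apply: (proj2 (meas_wrtP _ sG)); apply: measurable_funM; first exact: (proj1 (meas_wrtP _ sG)).
  by apply: measurable_indic; rewrite /measurable/= sigma_algebra_id.
by move=> w; rewrite mulr_ge0// indicE.
Qed.
End condexp.

(** * Decrease in expectation from a conditional one-step inequality *)

Section drift.
Context {R : realType} {dT : measure_display} {T : measurableType dT}.
Variable P : probability T R.
Implicit Types (G : set (set T)) (A : set T).

(* The pull-out property is only available for nonnegative functions: it is
   applied to [X^+ + Y^-] and [X^- + Y^+], and to [H] shifted by its bound. *)
Lemma Rintegral_condexp_mul0 G (X Y H : T -> R) A (M : R) :
  sigma_algebra setT G -> G `<=` measurable ->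
  is_cond_exp P G X Y -> meas_wrt G H -> G A -> (forall w, A w -> `|H w| <= M) ->
  P.-integrable A (EFin \o (fun w => H w * (X w - Y w))) /\
  \int[P]_(w in A) (H w * (X w - Y w)) = 0.
Proof.
move=> sG Gm [iX [mY [iY XY]]] mH GA HM.
have mA := Gm _ GA.
have mRH := meas_wrt_measurable Gm mH.
have mRX : measurable_fun setT X by apply/measurable_EFinP; case/integrableP: iX.
have mRY := meas_wrt_measurable Gm mY.
have iXY : P.-integrable setT (EFin \o (fun w => X w - Y w)).
  exact: (integrableB measurableT iX iY).
have iA B f : G B -> P.-integrable setT f -> P.-integrable B f.
  by move=> GB; apply: integrableS => //; exact: Gm.
have bnd (h f : T -> R) (C : R) : measurable_fun setT h ->
    (forall w, A w -> `|h w| <= C) -> P.-integrable setT (EFin \o f) ->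
    P.-integrable A (EFin \o (fun w => h w * f w)).
  move=> mh hC fi.
  apply: (@integrableMr _ _ _ P A mA h (EFin \o f)).
  - exact: measurable_funTS.
  - exists C; split; first exact: num_real.
    by move=> x Cx w Aw; apply: le_trans (hC _ Aw) (ltW Cx).
  - exact: iA.
split; first exact: (bnd _ _ M).
pose U w := Order.max (X w) 0 + Order.max (- Y w) 0.
pose V w := Order.max (- X w) 0 + Order.max (Y w) 0.
have UV w : U w - V w = X w - Y w.
  by rewrite /U /V; do 4 (case: ltP => ?); lra.
have mmax (f : T -> R) : measurable_fun setT f -> measurable_fun setT (fun w => Order.max (f w) 0).
  by move=> mf; exact: measurable_maxr.
have imax (f : T -> R) : P.-integrable setT (EFin \o f) ->
    P.-integrable setT (EFin \o (fun w => Order.max (f w) 0)).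
  move=> fi; have /integrableP[/measurable_EFinP mf _] := fi.
  apply: le_integrable fi => //; first exact/measurable_EFinP/mmax.
  move=> w _ /=; rewrite lee_fin maxC /Order.max; case: ifP => _ //.
  by rewrite normr0.
have iN (f : T -> R) : P.-integrable setT (EFin \o f) -> P.-integrable setT (EFin \o (fun w => - f w)).
  by move=> fi; exact: (integrableN fi).
have iU : P.-integrable setT (EFin \o U).
  by apply: (integrableD measurableT (imax _ _) (imax _ _)) => //; exact: iN.
have iV : P.-integrable setT (EFin \o V).
  by apply: (integrableD measurableT (imax _ _) (imax _ _)) => //; exact: iN.
have U0 w : 0 <= U w by rewrite addr_ge0// le_max lexx orbT.
have V0 w : 0 <= V w by rewrite addr_ge0// le_max lexx orbT.
have XY0 B : G B -> \int[P]_(w in B) (X w - Y w) = 0.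
  move=> GB; rewrite (RintegralB (Gm _ GB) (iA _ _ GB iX) (iA _ _ GB iY)).
  by rewrite /Rintegral XY// subrr.
have eUV B : G B -> (\int[P]_(w in B) (U w)%:E = \int[P]_(w in B) (V w)%:E)%E.
  move=> GB; have mB := Gm _ GB.
  rewrite -(fineK (integrable_fin_num mB (iA _ _ GB iU))).
  rewrite -(fineK (integrable_fin_num mB (iA _ _ GB iV))).
  congr EFin; apply/eqP; rewrite -subr_eq0; apply/eqP.
  rewrite -[LHS](RintegralB mB (iA _ _ GB iU) (iA _ _ GB iV)).
  by under eq_Rintegral do rewrite UV; exact: XY0.
(* Truncation at 0 makes [h] nonnegative everywhere; on [A] it equals [H + M]. *)
pose h w := Order.max (H w + M) 0.
have mh : meas_wrt G h.
  apply: (proj2 (meas_wrtP _ sG)); apply: measurable_maxr => //.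
  by apply: measurable_funD => //; exact: (proj1 (meas_wrtP _ sG)).
have hA w : A w -> h w = H w + M.
  by move=> /HM; rewrite ler_norml => /andP[? _]; rewrite /h; case: ltP => // ?; lra.
have hM w : A w -> `|h w| <= 2 * M.
  move=> Aw; rewrite (hA _ Aw); move: (HM _ Aw); rewrite !ler_norml => /andP[? ?].
  by apply/andP; split; lra.
have mRh := meas_wrt_measurable Gm mh.
have hUV : \int[P]_(w in A) (h w * (U w - V w)) = 0.
  under eq_Rintegral do rewrite mulrBr.
  rewrite (RintegralB mA (bnd _ _ _ mRh hM iU) (bnd _ _ _ mRh hM iV)).
  apply/eqP; rewrite subr_eq0; apply/eqP; congr fine.
  under eq_integral do rewrite EFinM.
  under [RHS]eq_integral do rewrite EFinM.
  apply: (@integral_pullout_on _ _ _ P G (EFin \o U) (EFin \o V)) => //.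
  - by case/integrableP: iU.
  - by case/integrableP: iV.
  - by move=> w; rewrite le_max lexx orbT.
(* Subtracting [M * (X - Y)] undoes the shift, and its integral over [A] vanishes because [A] is in
   [G]. *)
transitivity (\int[P]_(w in A) (h w * (U w - V w) - M * (X w - Y w))).
  by apply: eq_Rintegral => w; rewrite inE => /hA ->; rewrite UV; ring.
rewrite (RintegralB mA (bnd _ _ _ mRh hM (integrableB measurableT iU iV))
  (integrableZl mA M (iA _ _ GA iXY))).
rewrite hUV (RintegralZl _ mA (iA _ _ GA iXY)).
by rewrite XY0// mulr0 subr0.
Qed.

Lemma Rintegral_sum_eq0 (I : Type) (s : seq I) (h : I -> T -> R) A : measurable A ->
  (forall i, P.-integrable A (EFin \o h i) /\ \int[P]_(w in A) h i w = 0) ->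
  P.-integrable A (EFin \o (fun w => \sum_(i <- s) h i w)) /\
  \int[P]_(w in A) (\sum_(i <- s) h i w) = 0.
Proof.
move=> mA hi; elim: s => [|i s [ih1 ih2]].
  split; first by under eq_fun do rewrite big_nil; exact: integrable0.
  by under eq_Rintegral do rewrite big_nil; rewrite Rintegral_cst// mul0r.
have [hi1 hi2] := hi i.
split.
  have -> : EFin \o (fun w => \sum_(j <- i :: s) h j w) =
      ((EFin \o h i) \+ (EFin \o (fun w => (\sum_(j <- s) h j w)%R)))%E.
    by apply/funext => w /=; rewrite big_cons EFinD.
  exact: integrableD.
under eq_Rintegral do rewrite big_cons.
by rewrite (RintegralD mA hi1 ih1) hi2 ih2 addr0.
Qed.

(* [D] bounds [c * N1]; it makes [c * N1], and hence through [Y1] and [Y2] also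
   [c * z * N2], integrable on the events [A n] of the proof. *)
Lemma condexp_drift (d : nat) G (W W' D c z N1 N2 : T -> R) (H X Y : 'I_d -> T -> R)
    (Y1 Y2 : T -> \bar R) :
  sigma_algebra setT G -> G `<=` measurable ->
  meas_wrt G D -> meas_wrt G c -> meas_wrt G z -> (forall i, meas_wrt G (H i)) ->
  (forall w, 0 <= c w) -> (forall w, 0 <= z w) ->
  (forall i, is_cond_exp P G (X i) (Y i)) ->
  is_cond_exp_nonneg P G N1 Y1 -> is_cond_exp_nonneg P G N2 Y2 ->
  {ae P, forall w, ((z w)%:E * Y2 w <= Y1 w)%E} ->
  measurable_fun setT W' -> (forall w, 0 <= W' w) ->
  (forall w, 0 <= W w) -> P.-integrable setT (EFin \o W) ->
  (forall w, c w * N1 w <= D w) ->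
  (forall w, W' w + c w * N1 w + \sum_(i < d) H i w * (X i w - Y i w) <=
             W w + c w * z w * N2 w) ->
  (\int[P]_w (W' w)%:E <= \int[P]_w (W w)%:E)%E.
Proof.
move=> sG Gm mD mc mz mH c0 z0 XY [N10 [mN1 [mY1 [Y10 NY1]]]] [N20 [mN2 [mY2 [Y20 NY2]]]].
move=> zY mW' W'0 W0 iW cN1 le.
(* [K] is [G]-measurable and dominates [D] and every [|H i|], so all of these are at most [n] on
   [A n]. *)
pose K w := D w + \sum_(i < d) `|H i w|.
pose A (n : nat) := [set w | K w <= n%:R].
have mK : meas_wrt G K.
  apply: (proj2 (meas_wrtP _ sG)); apply: measurable_funD; first exact: (proj1 (meas_wrtP _ sG)).
  apply: measurable_sum => i; apply: measurableT_comp => //; exact: (proj1 (meas_wrtP _ sG)).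
have GA n : G (A n).
  have -> : A n = K @^-1` `]-oo, n%:R].
    by apply/seteqP; split => w /=; rewrite in_itv.
  exact: mK.
have mA n := Gm _ (GA n).
have D0 w : 0 <= D w by apply: le_trans (cN1 w); rewrite mulr_ge0.
have mGT (f : T -> R) : meas_wrt G f -> measurable_fun setT f by exact: meas_wrt_measurable.
have mcN1 : measurable_fun setT (fun w => c w * N1 w) by apply: measurable_funM => //; exact: mGT.
have mczN2 : measurable_fun setT (fun w => c w * z w * N2 w).
  by apply: measurable_funM => //; apply: measurable_funM; exact: mGT.
have mcz : meas_wrt G (fun w => c w * z w).
  by apply: (proj2 (meas_wrtP _ sG)); apply: measurable_funM; exact: (proj1 (meas_wrtP _ sG)).
have mY1T := emeas_wrt_measurable Gm mY1.
have mY2T := emeas_wrt_measurable Gm mY2.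
have mN1E : measurable_fun setT (EFin \o N1) by exact/measurable_EFinP.
have mN2E : measurable_fun setT (EFin \o N2) by exact/measurable_EFinP.
have N10E w : (0 <= (EFin \o N1) w)%E by rewrite lee_fin.
have N20E w : (0 <= (EFin \o N2) w)%E by rewrite lee_fin.
have cz0 w : 0 <= c w * z w by rewrite mulr_ge0.
have step n : (\int[P]_(w in A n) (W' w)%:E <= \int[P]_w (W w)%:E)%E.
  have KA w : A n w -> D w <= n%:R.
    by move=> /(le_trans _); apply; rewrite lerDl sumr_ge0.
  have HA i w : A n w -> `|H i w| <= n%:R.
    move=> /(le_trans _); apply; rewrite /K (bigD1 i)//= addrCA lerDl.
    by rewrite addr_ge0// sumr_ge0.
  have iN1 : P.-integrable (A n) (EFin \o (fun w => c w * N1 w)).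
    apply: measurable_bounded_integrable => //.
    - by rewrite (le_lt_trans (probability_le1 _ _))// ltry.
    - exact: measurable_funTS.
    - exists n%:R; split; first exact: num_real.
      move=> x nx w Aw; rewrite /= ger0_norm ?mulr_ge0//.
      by apply: le_trans (cN1 w) _; apply: le_trans (KA _ Aw) (ltW nx).
  (* After [N1] and [N2] are exchanged for [Y1] and [Y2], this is the almost sure bound
     [z * Y2 <= Y1] multiplied by [c]. *)
  have leN : (\int[P]_(w in A n) (c w * z w * N2 w)%:E <= \int[P]_(w in A n) (c w * N1 w)%:E)%E.
    under eq_integral do rewrite EFinM.
    under [leRHS]eq_integral do rewrite EFinM.
    rewrite (integral_pullout_on sG Gm mN2E mY2T N20E Y20 NY2 mcz cz0 (GA n)).
    rewrite (integral_pullout_on sG Gm mN1E mY1T N10E Y10 NY1 mc c0 (GA n)).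
    apply: ae_ge0_le_integral => //.
    - by move=> w _; rewrite mule_ge0// lee_fin mulr_ge0.
    - apply: measurable_funTS; apply: emeasurable_funM => //.
      by apply/measurable_EFinP; apply: measurable_funM; exact: mGT.
    - by move=> w _; rewrite mule_ge0// lee_fin.
    - apply: measurable_funTS; apply: emeasurable_funM => //.
      by apply/measurable_EFinP; exact: mGT.
    - apply: filterS zY => w zYw _; rewrite EFinM -muleA lee_wpmul2l// lee_fin//.
  have iN2 : P.-integrable (A n) (EFin \o (fun w => c w * z w * N2 w)).
    apply/integrableP; split.
      by apply/measurable_EFinP; exact: measurable_funTS.
    under eq_integral do rewrite /= ger0_norm ?mulr_ge0//.
    exact: le_lt_trans leN (integrable_lty (mA n) iN1).
  have iWA : P.-integrable (A n) (EFin \o W) by exact: (integrableS measurableT).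
  pose Q w := \sum_(i < d) H i w * (X i w - Y i w).
  have [iQ Q0] : P.-integrable (A n) (EFin \o Q) /\ \int[P]_(w in A n) Q w = 0.
    apply: Rintegral_sum_eq0 => // i.
    exact: (Rintegral_condexp_mul0 sG Gm (XY i) (mH i) (GA n) (HA i)).
  (* [le] bounds [W'] by integrable terms, since [c * N1] is nonnegative. *)
  have iW' : P.-integrable (A n) (EFin \o W').
    apply: (@le_integrable _ _ _ _ _ (mA n) _ (EFin \o (fun w => W w + c w * z w * N2 w - Q w))).
    - by apply/measurable_EFinP; exact: measurable_funTS.
    - move=> w Aw /=; rewrite lee_fin (ger0_norm (W'0 w)).
      apply: le_trans (ler_norm _); move: (le w); rewrite -/(Q w) => lew.
      by have := mulr_ge0 (c0 w) (N10 w); lra.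
    - exact: (integrableB (mA n) (integrableD (mA n) iWA iN2) iQ).
  (* On integrating [le], [Q] contributes 0, and by [leN] the [N1] term on the left outweighs the
     [N2] term on the right. *)
  have RW : \int[P]_(w in A n) W' w <= \int[P]_(w in A n) W w.
    have : \int[P]_(w in A n) (W' w + c w * N1 w + Q w) <=
           \int[P]_(w in A n) (W w + c w * z w * N2 w).
      apply: (le_Rintegral (mA n)) => [||w _]; last exact: le.
      - exact: (integrableD (mA n) (integrableD (mA n) iW' iN1) iQ).
      - exact: (integrableD (mA n) iWA iN2).
    rewrite (RintegralD (mA n) (integrableD (mA n) iW' iN1) iQ).
    rewrite (RintegralD (mA n) iW' iN1) (RintegralD (mA n) iWA iN2) Q0 addr0.
    have : \int[P]_(w in A n) (c w * z w * N2 w) <= \int[P]_(w in A n) (c w * N1 w).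
      by apply: fine_le => //; exact: integrable_fin_num.
    lra.
  apply: (@le_trans _ _ (\int[P]_(w in A n) (W w)%:E)%E).
    rewrite -(fineK (integrable_fin_num (mA n) iW')) -(fineK (integrable_fin_num (mA n) iWA)).
    by rewrite lee_fin.
  apply: ge0_subset_integral => //.
    by case/integrableP: iW.
  by move=> w _; rewrite lee_fin.
have AT : \bigcup_n A n = setT.
  apply/seteqP; split => // w _; exists (Num.bound `|K w|) => //=.
  by apply/ltW/(le_lt_trans (ler_norm _)); apply: archi_boundP.
rewrite -[X in (integral _ X _ <= _)%E]AT.
(* The bound is uniform in [n], so monotone convergence along the [A n] carries it to the whole
   space. *)
have cv : (\int[P]_(w in A n) (W' w)%:E @[n --> \oo] -->
    \int[P]_(w in \bigcup_n A n) (W' w)%:E)%E.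
  apply: ge0_nondecreasing_set_cvg_integral => //.
  - apply/nondecreasing_seqP => n; apply/subsetPset => w /= Kn.
    by apply: (le_trans Kn); rewrite ler_nat.
  - by move=> n; apply: measurable_funTS; exact/measurable_EFinP.
  - by move=> n w _; rewrite lee_fin.
rewrite -(cvg_lim _ cv)//; apply: lime_le; first exact: cvgP cv.
by apply: nearW => n; exact: step.
Qed.
End drift.

(** * The Euclidean inner product and norm *)

Section dotv_theory.
Context {R : realType} {d : nat}.
Implicit Types (u v w : 'rV[R]_d) (a : R).

Lemma dotvC u v : dotv u v = dotv v u.
Proof. by apply: eq_bigr => i _; rewrite mulrC. Qed.

Lemma dotvDl u v w : dotv (u + v) w = dotv u w + dotv v w.
Proof. by rewrite -big_split; apply: eq_bigr => i _; rewrite mxE mulrDl. Qed.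

Lemma dotvZl a u w : dotv (a *: u) w = a * dotv u w.
Proof. by rewrite /dotv mulr_sumr; apply: eq_bigr => i _; rewrite mxE mulrA. Qed.

Lemma dotvDr u v w : dotv w (u + v) = dotv w u + dotv w v.
Proof. by rewrite dotvC dotvDl !(dotvC _ w). Qed.

Lemma dotvZr a u w : dotv w (a *: u) = a * dotv w u.
Proof. by rewrite dotvC dotvZl dotvC. Qed.

Lemma dotvBl u v w : dotv (u - v) w = dotv u w - dotv v w.
Proof. by rewrite -scaleN1r dotvDl dotvZl mulN1r. Qed.

Lemma dotvBr u v w : dotv w (u - v) = dotv w u - dotv w v.
Proof. by rewrite dotvC dotvBl !(dotvC _ w). Qed.

Lemma dotv_sumr (I : Type) (s : seq I) (F : I -> 'rV[R]_d) w :
  dotv w (\sum_(i <- s) F i) = \sum_(i <- s) dotv w (F i).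
Proof.
elim: s => [|i s ih]; last by rewrite !big_cons dotvDr ih.
by rewrite !big_nil /dotv big1// => i _; rewrite mxE mulr0.
Qed.

Lemma dotvv_ge0 u : 0 <= dotv u u.
Proof. by apply: sumr_ge0 => i _; rewrite -expr2 sqr_ge0. Qed.

Lemma sqr_norm2 u : norm2 u ^+ 2 = dotv u u.
Proof. by rewrite sqr_sqrtr// dotvv_ge0. Qed.

Lemma norm2_ge0 u : 0 <= norm2 u.
Proof. exact: sqrtr_ge0. Qed.

Lemma norm2Z a u : norm2 (a *: u) = `|a| * norm2 u.
Proof.
by rewrite /norm2 dotvZl dotvZr mulrA -expr2 sqrtrM ?sqr_ge0// sqrtr_sqr.
Qed.

Lemma norm2_eq0 u : norm2 u = 0 -> u = 0.
Proof.
move=> u0; have : dotv u u = 0 by rewrite -sqr_norm2 u0 expr0n.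
move=> /psumr_eq0P uu; apply/rowP => i; rewrite mxE; apply/eqP.
have := uu (fun i _ => _) i isT; rewrite -expr2 => /(_ _)/eqP.
by rewrite sqrf_eq0; apply => j; rewrite -expr2 sqr_ge0.
Qed.

(** Cauchy-Schwarz: expand the nonnegative square of [|v| u - |u| v] and divide by [|u| |v|]. *)
Lemma dotv_norm2_le u v : dotv u v <= norm2 u * norm2 v.
Proof.
have [u0|u0] := eqVneq (norm2 u) 0.
  by rewrite (norm2_eq0 u0) -(scale0r 0) dotvZl mul0r mulr_ge0// norm2_ge0.
have [v0|v0] := eqVneq (norm2 v) 0.
  by rewrite (norm2_eq0 v0) -(scale0r 0) dotvZr mul0r mulr_ge0// norm2_ge0.
have uv : 0 < norm2 u * norm2 v by rewrite mulr_gt0// lt0r ?u0 ?v0 norm2_ge0.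
have := dotvv_ge0 (norm2 v *: u - norm2 u *: v).
rewrite dotvBl !dotvBr !dotvZl !dotvZr -!sqr_norm2 (dotvC v u) => h.
rewrite -(ler_pM2l uv); lra.
Qed.

End dotv_theory.

(** * First-order inequalities for smooth and for convex functions *)

Section smooth_convex.
Context {R : realType} {d : nat}.
Variables (f : 'rV[R]_d -> R) (L : R).
Hypothesis sf : L_smooth L f.
Implicit Types x u : 'rV[R]_d.

Lemma diff_grad x u : 'd f x u = dotv (grad f x) u.
Proof.
rewrite {1}(row_sum_delta u) linear_sum/=; apply: eq_bigr => i _.
by rewrite linearZ/= /grad mxE mulrC.
Qed.

Lemma is_derive_line x u (s : R) :
  is_derive s 1 (fun s : R => f (x + s *: u)) (dotv (grad f (x + s *: u)) u).
Proof.
have df := sf.1 (x + s *: u).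
have E : (fun h : R => h^-1 *: (((fun s : R => f (x + s *: u)) \o shift s) (h *: (1 : R)) - f (x + s *: u)))
   = (fun h : R => h^-1 *: ((f \o shift (x + s *: u)) (h *: u) - f (x + s *: u))).
  apply/funext => h /=; congr (_ *: (f _ - _)).
  by rewrite scaler1 scalerDl addrCA.
apply: DeriveDef.
  by rewrite /derivable E; exact: diff_derivable.
by rewrite /derive E -diff_grad -deriveE.
Qed.

(** The mean value theorem is applied on [[0, 1]] to [f (x + s u)] minus the quadratic
    [s a + s^2 b]. The derivative of this difference is nonpositive, by Cauchy-Schwarz and the
    Lipschitz bound on the gradient. *)
Lemma smooth_descent x u :
  f (x + u) <= f x + dotv (grad f x) u + L / 2 * dotv u u.
Proof.
pose a := dotv (grad f x) u; pose b := L / 2 * dotv u u.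
pose q : R -> R := id * cst a + id ^+ 2 * cst b.
have qE s : q s = s * a + s ^+ 2 * b by rewrite /q fctE.
pose g : R -> R := (fun s => f (x + s *: u)) - q.
have gE s : g s = f (x + s *: u) - (s * a + s ^+ 2 * b) by rewrite -qE.
have dq (s : R) : is_derive s 1 q (a + 2 * s * b).
  apply: is_derive_eq; rewrite !scaler0 !add0r expr1 /GRing.scale/=; ring.
have dg (s : R) : is_derive s 1 g (dotv (grad f (x + s *: u)) u - (a + 2 * s * b)).
  by apply: is_deriveB; exact: is_derive_line.
have [c c01 E] : exists2 c : R, c \in `]0, 1[ & g 1 - g 0 =
    (dotv (grad f (x + c *: u)) u - (a + 2 * c * b)) * (1 - 0).
  apply: (MVT (df := fun c => dotv (grad f (x + c *: u)) u - (a + 2 * c * b))) => //.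
  by apply: derivable_within_continuous => s _; case: (dg s).
move: c01; rewrite in_itv/= => /andP[c0 c1].
have : dotv (grad f (x + c *: u)) u - (a + 2 * c * b) <= 0.
  rewrite subr_le0 -lerBlDl -dotvBl; apply: le_trans (dotv_norm2_le _ _) _.
  have := sf.2 (x + c *: u) x; rewrite [x + _]addrC addrK norm2Z gtr0_norm// => h.
  have := ler_wpM2r (norm2_ge0 u) h; rewrite /b -sqr_norm2; lra.
rewrite subr0 mulr1 in E; rewrite -E !gE scale1r scale0r addr0 expr1n expr0n !mul0r !mul1r addr0 subr0.
by rewrite subr_le0 lerBlDr -addrA addrC -addrA [b + _]addrC.
Qed.

(** By convexity the difference quotients in direction [y - x] with step in []0, 1]] are at most
    [f y - f x]; the limit from the right is the directional derivative. *)
Lemma convex_grad_le x y : convex_fun f -> f x + dotv (grad f x) (y - x) <= f y.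
Proof.
move=> cf; rewrite -lerBrDl -diff_grad -deriveE; last exact: sf.1.
have cv : h^-1 *: ((f \o shift x) (h *: (y - x)) - f x) @[h --> 0^'] --> 'D_(y - x) f x.
  exact: (diff_derivable (sf.1 x)).
have cvr : h^-1 *: ((f \o shift x) (h *: (y - x)) - f x) @[h --> 0^'+] --> 'D_(y - x) f x.
  by move=> A /cv[e e0 Ae]; exists e => // h he h0; apply: Ae => //; exact: lt0r_neq0.
rewrite -(cvg_lim _ cvr)//; apply: limr_le; first exact: cvgP cvr.
near=> h.
have h0 : 0 < h by [].
have h1 : h <= 1 by near: h; exact: nbhs_right_le.
have := cf x y h; rewrite (ltW h0) h1 => /(_ isT).
rewrite /= [h *: (y - x) + x](_ : _ = (1 - h) *: x + h *: y); last first.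
  by rewrite scalerBr scalerBl scale1r addrC addrA addrAC.
move=> le; rewrite [leLHS]mulrC ler_pdivrMr//; lra.
Unshelve. all: by end_near.
Qed.
End smooth_convex.

(** * Measurability of inverses, square roots and continuous functions of random vectors *)

Section measurability.
Context {R : realType} {dT : measure_display} {T : measurableType dT}.

Lemma measurable_fun_inv_ge0 (X : T -> R) : (forall w, 0 <= X w) ->
  measurable_fun setT X -> measurable_fun setT (fun w => (X w)^-1).
Proof.
move=> X0 mX; have -> : (fun w => (X w)^-1) = (fun w => X w `^ (-1)).
  by apply/funext => w; rewrite powR_inv1.
exact: (measurableT_comp (measurable_powR _)).
Qed.

Lemma measurable_sqrtr : measurable_fun setT (@Num.sqrt R).
Proof. by apply: continuous_measurable_fun; exact: sqrt_continuous. Qed.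

(* [f] is the pointwise limit of its compositions with the rounding of the
   coordinates to multiples of [1 / n.+1], which takes countably many values. *)
Lemma measurable_comp_rV (d : nat) (f : 'rV[R]_d -> R) (X : T -> 'rV[R]_d) :
  continuous f -> (forall i, measurable_fun setT (fun w => X w 0 i)) ->
  measurable_fun setT (fun w => f (X w)).
Proof.
move=> cf mX.
pose k (n : nat) w : 'rV[int]_d := \row_i Num.floor (n.+1%:R * X w 0 i).
pose e (n : nat) (z : 'rV[int]_d) : 'rV[R]_d := \row_i ((z 0 i)%:~R / n.+1%:R).
apply: (@measurable_fun_cvg _ _ _ _ (fun n w => f (e n (k n w)))).
  move=> n _ B mB; rewrite setTI.
  have -> : (fun w => f (e n (k n w))) @^-1` B =
      \bigcup_z (if `[< B (f (e n z)) >] then [set w | k n w = z] else set0).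
    apply/seteqP; split => [w /= Bw|w [z _]].
      by exists (k n w) => //; case: asboolP.
    by case: asboolP => //= Bz ->.
  apply: countable_bigcupT_measurable => [|z]; first exact: countableP.
  case: ifP => // _.
  have -> : [set w | k n w = z] = \bigcap_(i in [set: 'I_d])
      [set w | Num.floor (n.+1%:R * X w 0 i) = z 0 i].
    apply/seteqP; split => [w /= <- i _|w /= kz]; first by rewrite mxE.
    by apply/rowP => i; rewrite mxE; exact: kz.
  apply: fin_bigcap_measurable => // i _.
  have -> : [set w | Num.floor (n.+1%:R * X w 0 i) = z 0 i] =
      (fun w => n.+1%:R * X w 0 i) @^-1` `[(z 0 i)%:~R, (z 0 i + 1)%:~R[.
    apply/seteqP; split => w /=; rewrite in_itv/= -floor_eq; by move/eqP.
  rewrite -[X in measurable X]setTI.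
  have mM : measurable_fun setT (fun w => n.+1%:R * X w 0 i) by exact: measurable_funM.
  exact: mM.
move=> w _; apply: (@cvg_comp _ _ _ (fun n => e n (k n w)) f _ (nbhs (X w))); last exact: cf.
apply/cvgrPdist_lt => eps eps0; near=> n.
rewrite [ltLHS]mx_normrE; apply: bigmax_lt => // -[i j] _ /=; rewrite !mxE (ord1 i).
have := floor_itv (n.+1%:R * X w 0 j).
rewrite intrD => /andP[h1 h2].
have n0 : 0 < n.+1%:R :> R by [].
rewrite -(ltr_pM2l n0) -{1}(gtr0_norm n0) -normrM mulrBr mulrCA divff ?gt_eqF// mulr1.
rewrite ger0_norm ?subr_ge0//.
(* Rounding moves a coordinate by less than [1 / n.+1], which is below [eps] once [n] exceeds
   [1 / eps]. *)
have : 1 < n.+1%:R * eps.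
  rewrite -ltr_pdivrMr// div1r; apply: (@lt_trans _ _ n%:R); last by rewrite ltr_nat.
  by near: n; exact: nbhs_infty_gtr.
lra.
Unshelve. all: by end_near.
Qed.
End measurability.

Lemma measurable_dotv {R : realType} {dT : measure_display} {T : measurableType dT}
    (d : nat) (X Y : T -> 'rV[R]_d) :
  (forall i, measurable_fun setT (fun w => X w 0 i)) ->
  (forall i, measurable_fun setT (fun w => Y w 0 i)) ->
  measurable_fun setT (fun w => dotv (X w) (Y w)).
Proof. by move=> mX mY; apply: measurable_sum => i; exact: measurable_funM. Qed.

(** [g] is the orthogonal projection of [u], so [g] and [u] have the same inner products with [v]
    and every [p i], hence with [g], which they span. *)
Lemma dotv_proj {R : realType} (d s : nat) (u v : 'rV[R]_d) (p : 'I_s -> 'rV[R]_d) :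
  dotv v v = 1 -> (forall i, dotv v (p i) = 0) ->
  (forall i j, dotv (p i) (p j) = (i == j)%:R) ->
  let g := dotv u v *: v + \sum_(i < s) dotv u (p i) *: p i in
  dotv u g = dotv g g.
Proof.
move=> vv vp pp g.
have gv : dotv g v = dotv u v.
  rewrite dotvC dotvDr dotvZr vv mulr1 dotv_sumr big1 ?addr0// => i _.
  by rewrite dotvZr vp mulr0.
have gp j : dotv g (p j) = dotv u (p j).
  rewrite dotvC dotvDr dotvZr (dotvC (p j) v) vp mulr0 add0r dotv_sumr (bigD1 j)//=.
  rewrite dotvZr pp eqxx mulr1 big1 ?addr0// => i ij.
  by rewrite dotvZr pp eq_sym (negbTE ij) mulr0.
rewrite {1 3}/g !dotvDr !dotvZr !dotv_sumr gv; congr (_ + _).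
by apply: eq_bigr => i _; rewrite !dotvZr gp.
Qed.

(** The Lyapunov function [(f th - f thstar) / g + |m - thstar|^2 / 2] of accelerated gradient
    methods, scaled by [g0] so that its initial value is the right-hand side of the theorem. *)
Definition potential {R : realType} (d : nat) (f : 'rV[R]_d -> R) (thstar : 'rV[R]_d)
    (g0 g : R) (th m : 'rV[R]_d) : R :=
  g0 / g * (f th - f thstar) + g0 / 2 * dotv (m - thstar) (m - thstar).

(** * Deterministic inequality for one iteration *)

Section one_step.
Context {R : realType} {d : nat}.
Variables (f : 'rV[R]_d -> R) (L Lhat : R) (thstar : 'rV[R]_d).
Hypotheses (cf : convex_fun f) (sf : L_smooth L f) (LLhat : L <= Lhat) (Lhat0 : 0 < Lhat).

(** The linear term gives [- |g|^2 / Lhat], and since [L <= Lhat] the quadratic term gives back at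
    most half of it. *)
Lemma descent_step (x g : 'rV[R]_d) : dotv (grad f x) g = dotv g g ->
  f (x - Lhat^-1 *: g) + dotv g g / (2 * Lhat) <= f x.
Proof.
move=> xg; have := smooth_descent sf x (- (Lhat^-1 *: g)).
rewrite -scaleNr !dotvZr !dotvZl xg => le.
have : L * (dotv g g * Lhat^-1 ^+ 2) <= Lhat * (dotv g g * Lhat^-1 ^+ 2).
  by rewrite ler_wpM2r// mulr_ge0 ?dotvv_ge0// sqr_ge0.
have -> : Lhat * (dotv g g * Lhat^-1 ^+ 2) = dotv g g * Lhat^-1 by field; rewrite gt_eqF.
rewrite invfM; lra.
Qed.

(** Shaped for [condexp_drift]: the sum is the error of replacing [g2] by the gradient in the cross
    term, and has conditional mean zero; the factor [z * Lhat] is the one that the step size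
    condition compares. *)
Lemma potential_step (g0 z a g : R) (th m g1 g2 : 'rV[R]_d) :
  let x := (1 - a) *: th + a *: m in
  let c := g0 / (2 * Lhat * ((1 - a) * g)) in
  0 < g0 -> 0 < g -> 0 < a < 1 -> a ^+ 2 = z * g * (1 - a) ->
  dotv (grad f x) g1 = dotv g1 g1 ->
  potential f thstar g0 ((1 - a) * g) (x - Lhat^-1 *: g1) (m - (z / a) *: g2) +
    c * dotv g1 g1 +
    \sum_(i < d) g0 * (z / a) * (m - thstar) 0 i * (g2 0 i - grad f x 0 i) <=
  potential f thstar g0 g th m + c * (z * Lhat) * dotv g2 g2.
Proof.
move=> x c g00 gp /andP[a0 a1] a2 xg1.
have -> : \sum_(i < d) g0 * (z / a) * (m - thstar) 0 i * (g2 0 i - grad f x 0 i) =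
    g0 * (z / a) * (dotv (m - thstar) g2 - dotv (grad f x) (m - thstar)).
  rewrite (dotvC (grad f x)) -dotvBr mulr_sumr; apply: eq_bigr => i _.
  by rewrite !mxE; ring.
have a1p : 0 < 1 - a by rewrite subr_gt0.
have an0 : a != 0 by rewrite gt_eqF.
(* With [i] the inverse of the next [gamma], the root equation reads [z = a^2 i], and every
   coefficient becomes polynomial in [a] and [i]. *)
pose i := ((1 - a) * g)^-1.
have i0 : 0 < i by rewrite invr_gt0 mulr_gt0.
have zE : z = a ^+ 2 * i.
  by rewrite a2 /i; field; rewrite !gt_eqF.
have kE : z / a = a * i by rewrite zE; field.
have gE : g0 / g = g0 * (1 - a) * i by rewrite /i; field; rewrite !gt_eqF.
have cE : c = g0 * i / (2 * Lhat).
  by rewrite /c /i; field; rewrite !gt_eqF.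
have czE : c * (z * Lhat) = g0 * i ^+ 2 * a ^+ 2 / 2.
  by rewrite cE zE; field; rewrite gt_eqF.
rewrite /potential -/i kE gE czE cE.
rewrite [m - _ - _]addrAC.
have des := descent_step xg1.
(* Convexity at [x] is used towards [th] with weight [1 - a] and towards [thstar] with weight [a];
   the definition of [x] gives [a (m - thstar) = - (1 - a) (th - x) - a (thstar - x)]. *)
have grad_m : f x - f thstar - (1 - a) * (f th - f thstar) <= a * dotv (grad f x) (m - thstar).
  have h1 := convex_grad_le sf x th cf.
  have h2 := convex_grad_le sf x thstar cf.
  have -> : a * dotv (grad f x) (m - thstar) =
      - (1 - a) * dotv (grad f x) (th - x) - a * dotv (grad f x) (thstar - x).
    by rewrite -!dotvZr -dotvBr; congr dotv; apply/rowP => j; rewrite /x !mxE; ring.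
  have := ler_wpM2l (ltW a1p) h1; have := ler_wpM2l (ltW a0) h2; lra.
(* This is what remains of the goal once the [|g2|^2] terms and the cross terms in [g2] cancel. *)
have : 0 <= g0 * i * (a * dotv (grad f x) (m - thstar) + (1 - a) * (f th - f thstar)
   + f thstar - f (x - Lhat^-1 *: g1) - dotv g1 g1 / (2 * Lhat)).
  by apply: mulr_ge0; [rewrite mulr_ge0 ?ltW | lra].
move: (m - thstar) => u.
rewrite dotvBl !dotvBr !dotvZl !dotvZr (dotvC g2).
lra.
Qed.

End one_step.

(** With [G], [G'] the roots of the old and new [gamma], the equation says [a = sqrt z * G'], while
    [1 - a <= (1 - a / 2)^2] gives [G - G' >= a G / 2]; dividing by [G G'] yields the increment
    [sqrt z / 2]. *)
Lemma inv_sqrt_growth {R : realType} (z a g : R) :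
  0 < g -> 0 < z -> 0 < a < 1 -> a ^+ 2 = z * g * (1 - a) ->
  (Num.sqrt g)^-1 + Num.sqrt z / 2 <= (Num.sqrt ((1 - a) * g))^-1.
Proof.
move=> g0 z0 /andP[a0 a1] a2.
have a1p : 0 < 1 - a by rewrite subr_gt0.
set G := Num.sqrt g; set G' := Num.sqrt ((1 - a) * g); set Z := Num.sqrt z.
have GG : G ^+ 2 = g by rewrite sqr_sqrtr// ltW.
have GG' : G' ^+ 2 = (1 - a) * g by rewrite sqr_sqrtr// mulr_ge0 ?ltW.
have G0 : 0 < G by rewrite sqrtr_gt0.
have G'0 : 0 < G' by rewrite sqrtr_gt0 mulr_gt0.
have Z0 : 0 <= Z by exact: sqrtr_ge0.
have aE : a = Z * G'.
  apply/eqP; rewrite -(eqrXn2 (n := 2))//; [|exact: ltW|exact: mulr_ge0 Z0 (ltW G'0)].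
  by rewrite exprMn GG' sqr_sqrtr ?ltW// a2; apply/eqP; ring.
have le : G' <= G * (1 - a / 2).
  have a2p : 0 <= 1 - a / 2 by lra.
  rewrite -(ler_pXn2r (n := 2))// ?nnegrE; [|exact: ltW|exact: mulr_ge0 (ltW G0) a2p].
  rewrite exprMn GG GG'; have := mulr_ge0 (ltW g0) (sqr_ge0 a); lra.
rewrite -(@ler_pM2r _ (G * G')) ?mulr_gt0//.
have -> : (G^-1 + Z / 2) * (G * G') = G' + a * G / 2.
  by rewrite aE; field; rewrite gt_eqF.
have -> : G'^-1 * (G * G') = G by field; rewrite gt_eqF.
lra.
Qed.

(** The closed form shows that [alpha t] is measurable with respect to [F t]. *)
Lemma positive_root {R : realType} (k a : R) : 0 <= k -> 0 <= a ->
  a ^+ 2 = k * (1 - a) -> a = (Num.sqrt (k ^+ 2 + 4 * k) - k) / 2.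
Proof.
move=> k0 a0 a2; have -> : k ^+ 2 + 4 * k = (2 * a + k) ^+ 2.
  by apply/eqP; rewrite -subr_eq0; apply/eqP; transitivity (4 * (k * (1 - a) - a ^+ 2));
    [ring|rewrite a2 subrr mulr0].
rewrite sqrtr_sqr ger0_norm; last by rewrite addr_ge0// mulr_ge0.
by field.
Qed.

(** * Adaptedness of the iterates, decrease of the expected potential, and the resulting rate *)

Theorem theorem2 (R : realType) (d s : nat) (f : 'rV[R]_d -> R) (L Lhat gamma0 : R)
  (thstar theta0 : 'rV[R]_d) (T : nat)
  (dT : measure_display) (Om : measurableType dT) (P : probability Om R)
  (F : nat -> set (set Om))
  (zeta alpha gam : nat -> Om -> R)
  (theta m thtil v g2 : nat -> Om -> 'rV[R]_d)
  (p : nat -> 'I_s -> Om -> 'rV[R]_d) :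
  convex_fun f -> 0 <= L -> L_smooth L f ->
  (forall th, f thstar <= f th) ->
  L <= Lhat -> 0 < Lhat -> 0 < gamma0 ->
  filtration F ->
  (forall w, theta 0%N w = theta0) -> (forall w, m 0%N w = theta0) ->
  (forall w, gam 0%N w = gamma0) ->
  (forall t, (t < T)%N ->
    let g1 := fun w =>
      dotv (grad f (thtil t w)) (v t w) *: v t w +
      \sum_(i < s) dotv (grad f (thtil t w)) (p t i w) *: p t i w in
    (* (i) *)
    (forall w, 0 < zeta t w) /\ meas_wrt (F t) (zeta t) /\
    (* (ii) *)
    (forall w, 0 < alpha t w < 1 /\
               alpha t w ^+ 2 = zeta t w * gam t w * (1 - alpha t w)) /\
    (forall w, thtil t w = (1 - alpha t w) *: theta t w + alpha t w *: m t w) /\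
    (forall w, gam t.+1 w = (1 - alpha t w) * gam t w) /\
    (* (iii) random orthonormal family, revealed by time t+1 *)
    vmeas_wrt (F t.+1) (v t) /\ (forall i, vmeas_wrt (F t.+1) (p t i)) /\
    vmeas_wrt (F t.+1) (g2 t) /\
    (forall w, dotv (v t w) (v t w) = 1 /\
       (forall i, dotv (v t w) (p t i w) = 0) /\
       (forall i j, dotv (p t i w) (p t j w) = (i == j)%:R)) /\
    (forall i : 'I_d, is_cond_exp P (F t) (fun w => g2 t w 0 i)
                                         (fun w => grad f (thtil t w) 0 i)) /\
    (* (iv) *)
    (exists Y1 Y2 : Om -> \bar R,
       is_cond_exp_nonneg P (F t) (fun w => norm2 (g1 w) ^+ 2) Y1 /\
       is_cond_exp_nonneg P (F t) (fun w => norm2 (g2 t w) ^+ 2) Y2 /\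
       {ae P, forall w, ((zeta t w * Lhat)%:E * Y2 w <= Y1 w)%E}) /\
    (* (v) *)
    (forall w, theta t.+1 w = thtil t w - Lhat^-1 *: g1 w) /\
    (forall w, m t.+1 w = m t w - (zeta t w / alpha t w) *: g2 t w)) ->
  (\int[P]_w ((f (theta T w) - f thstar) *
      (1 + Num.sqrt gamma0 / 2 * \sum_(t < T) Num.sqrt (zeta t w)) ^+ 2)%:E
   <= (f theta0 - f thstar + gamma0 / 2 * norm2 (theta0 - thstar) ^+ 2)%:E)%E.
Proof.
move=> cf L0 sf fmin LLh Lh0 g00 filt th0 m0 gam0 algo.
have mP t (X : Om -> R) := @meas_wrtP R _ _ (F t) X (filt t).1.
have sub t (X : Om -> R) : meas_wrt (F t) X -> meas_wrt (F t.+1) X.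
  by move=> mX B mB; apply: (filt t).2.2; exact: mX.
have cnt : continuous f by move=> x; exact: differentiable_continuous (sf.1 x).
have gam_gt0 t : (t <= T)%N -> forall w, 0 < gam t w.
  elim: t => [_ w|t ih tT w]; first by rewrite gam0.
  have [_ [_ [al [_ [gamS _]]]]] := algo t tT.
  have [/andP[_ a1] _] := al w.
  by rewrite gamS mulr_gt0 ?subr_gt0// ih// ltnW.
have malpha t : (t < T)%N -> meas_wrt (F t) (gam t) -> meas_wrt (F t) (alpha t).
  move=> tT mg; have [z0 [mz [al _]]] := algo t tT.
  have -> : alpha t = fun w =>
      (Num.sqrt ((zeta t w * gam t w) ^+ 2 + 4 * (zeta t w * gam t w)) - zeta t w * gam t w) / 2.
    apply/funext => w; have [/andP[a0 _] a2] := al w.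
    by apply: positive_root => //; rewrite ?mulr_ge0// ltW// gam_gt0// ltnW.
  have mk := measurable_funM (proj1 (mP _ _) mz) (proj1 (mP _ _) mg).
  apply/mP; apply: measurable_funM => //; apply: measurable_funB => //.
  apply: (measurableT_comp measurable_sqrtr); apply: measurable_funD.
    exact: measurable_funX.
  exact: measurable_funM.
have mtil t : (t < T)%N -> meas_wrt (F t) (gam t) -> vmeas_wrt (F t) (theta t) ->
    vmeas_wrt (F t) (m t) -> vmeas_wrt (F t) (thtil t).
  move=> tT mg mth mm i; have [_ [_ [_ [til _]]]] := algo t tT.
  have -> : (fun w => thtil t w 0 i) =
      (fun w => (1 - alpha t w) * theta t w 0 i + alpha t w * m t w 0 i).
    by apply/funext => w; rewrite til !mxE.
  have ma := proj1 (mP _ _) (malpha _ tT mg).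
  apply/mP; apply: measurable_funD; apply: measurable_funM => //.
  - exact: measurable_funB.
  - exact/mP.
  - exact/mP.
have meas t : (t <= T)%N -> meas_wrt (F t) (gam t) /\ vmeas_wrt (F t) (theta t) /\
    vmeas_wrt (F t) (m t).
  elim: t => [_|t ih tT].
    split; first by apply/mP; rewrite (funext gam0).
    split=> i; apply/mP.
      by rewrite (_ : (fun w => _) = cst (theta0 0 i))//; apply/funext => w; rewrite th0.
    by rewrite (_ : (fun w => _) = cst (theta0 0 i))//; apply/funext => w; rewrite m0.
  have [mg [mth mm]] := ih (ltnW tT).
  have [z0 [mz [al [til [gamS [mv [mp [mg2 [_ [cg [_ [thS mS]]]]]]]]]]]] := algo t tT.
  have ma := proj1 (mP _ _) (sub _ _ (malpha _ tT mg)).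
  have mt := mtil _ tT mg mth mm.
  split.
    rewrite (funext gamS); apply/mP; apply: measurable_funM; last exact/mP/sub.
    exact: measurable_funB.
  (* Measurability of the gradient is read off the conditional expectation of [g2], of which it is a
     version. *)
  have mgr i : measurable_fun (setT : set (g_sigma_algebraType (F t.+1)))
      (fun w => grad f (thtil t w) 0 i).
    by apply/mP/sub; have [_ []] := cg i.
  have mvi i := proj1 (mP _ _) (mv i).
  have mpi j i := proj1 (mP _ _) (mp j i).
  split => i; apply/mP.
    rewrite (_ : (fun w => _) = fun w => thtil t w 0 i - Lhat^-1 *
        (dotv (grad f (thtil t w)) (v t w) * v t w 0 i +
         \sum_(j < s) dotv (grad f (thtil t w)) (p t j w) * p t j w 0 i)); last first.
      apply/funext => w; rewrite thS !mxE summxE; congr (_ - _ * (_ + _)).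
      by apply: eq_bigr => j _; rewrite mxE.
    apply: measurable_funB; first exact/mP/sub.
    apply: measurable_funM => //; apply: measurable_funD.
      by apply: measurable_funM => //; exact: measurable_dotv.
    apply: measurable_sum => j; apply: measurable_funM => //.
    exact: measurable_dotv.
  rewrite (_ : (fun w => _) = fun w => m t w 0 i - zeta t w * (alpha t w)^-1 * g2 t w 0 i);
    last by apply/funext => w; rewrite mS !mxE.
  apply: measurable_funB; first exact/mP/sub.
  apply: measurable_funM; last exact/mP.
  apply: measurable_funM; first exact/mP/sub.
  by apply: measurable_fun_inv_ge0 => // w; have [/andP[/ltW]] := al w.
pose W t w := potential f thstar gamma0 (gam t w) (theta t w) (m t w).
have W0 t w : (t <= T)%N -> 0 <= W t w.
  move=> tT; rewrite addr_ge0// mulr_ge0 ?dotvv_ge0 ?subr_ge0//.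
    by rewrite divr_ge0// ltW// gam_gt0.
  by rewrite divr_ge0// ltW.
have mginv t : (t <= T)%N -> measurable_fun (setT : set (g_sigma_algebraType (F t)))
    (fun w => (gam t w)^-1).
  move=> tT; apply: measurable_fun_inv_ge0 => [w|]; first exact/ltW/gam_gt0.
  by apply/mP; have [] := meas t tT.
have mmst t i : (t <= T)%N -> measurable_fun (setT : set (g_sigma_algebraType (F t)))
    (fun w => (m t w - thstar) 0 i).
  move=> tT; rewrite (_ : (fun w => _) = fun w => m t w 0 i - thstar 0 i); last first.
    by apply/funext => w; rewrite !mxE.
  by apply: measurable_funB => //; apply/mP; have [_ []] := meas t tT.
have mW t : (t <= T)%N -> meas_wrt (F t) (W t).
  move=> tT; have [mg [mth mm]] := meas t tT.
  apply/mP; apply: measurable_funD.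
    apply: measurable_funM; first by apply: measurable_funM => //; exact: mginv.
    apply: measurable_funB => //; apply: measurable_comp_rV => // i; exact/mP.
  apply: measurable_funM => //; apply: measurable_dotv => i; exact: mmst.
have mWT t : (t <= T)%N -> measurable_fun setT (W t).
  by move=> tT; apply: meas_wrt_measurable (filt t).2.1 (mW t tT).
pose K : R := f theta0 - f thstar + gamma0 / 2 * norm2 (theta0 - thstar) ^+ 2.
(* The induction hypothesis also makes [W t] integrable, as the next application of [condexp_drift]
   requires. *)
have EW t : (t <= T)%N -> (\int[P]_w (W t w)%:E <= K%:E)%E.
  elim: t => [_|t ih tT].
    under eq_integral do
      rewrite /W /potential th0 m0 gam0 divff ?gt_eqF// mul1r -sqr_norm2 -/K.
    by rewrite integral_cst//= probability_setT mule1.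
  apply: le_trans (ih (ltnW tT)).
  have tT' := ltnW tT; have [mg [mth mm]] := meas t tT'.
  have [z0 [mz [al [til [gamS [_ [_ [_ [orth [cg [[Y1 [Y2 [CY1 [CY2 YY]]]] [thS mS]]]]]]]]]]]] :=
    algo t tT.
  pose g1 w := dotv (grad f (thtil t w)) (v t w) *: v t w +
      \sum_(i < s) dotv (grad f (thtil t w)) (p t i w) *: p t i w.
  have g1E w : dotv (grad f (thtil t w)) (g1 w) = dotv (g1 w) (g1 w).
    by have [vv [vp pp]] := orth w; exact: dotv_proj.
  pose c w := gamma0 / (2 * Lhat * gam t.+1 w).
  (* [gam t.+1] is already known at time [t], being computed from [alpha t] and [gam t]; hence [c]
     is an admissible factor. *)
  have mgS : measurable_fun (setT : set (g_sigma_algebraType (F t))) (fun w => (gam t.+1 w)^-1).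
    apply: measurable_fun_inv_ge0 => [w|]; first exact/ltW/gam_gt0.
    rewrite (funext gamS); apply: measurable_funM; last exact/mP.
    by apply: measurable_funB => //; apply/mP; exact: malpha.
  have ginv0 w : 0 <= (gam t.+1 w)^-1 by rewrite invr_ge0 ltW// gam_gt0.
  apply: (@condexp_drift _ _ _ P d (F t) _ _
    (fun w => gamma0 / gam t.+1 w * (f (thtil t w) - f thstar)) c (fun w => zeta t w * Lhat)
    (fun w => norm2 (g1 w) ^+ 2) (fun w => norm2 (g2 t w) ^+ 2)
    (fun i w => gamma0 * (zeta t w / alpha t w) * (m t w - thstar) 0 i)
    (fun i w => g2 t w 0 i) (fun i w => grad f (thtil t w) 0 i) Y1 Y2
    (filt t).1 (filt t).2.1) => //.
  - apply/mP; apply: measurable_funM; first exact: measurable_funM.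
    apply: measurable_funB => //; apply: measurable_comp_rV => // i.
    by apply/mP; exact: mtil.
  - apply/mP; rewrite (_ : c = fun w => gamma0 / (2 * Lhat) * (gam t.+1 w)^-1).
      exact: measurable_funM.
    by apply/funext => w; rewrite /c invfM mulrA.
  - by apply/mP; apply: measurable_funM => //; exact/mP.
  - move=> i; apply/mP; apply: measurable_funM; last exact: mmst.
    apply: measurable_funM => //; apply: measurable_funM; first exact/mP.
    apply: measurable_fun_inv_ge0 => [w|]; first by have [/andP[/ltW]] := al w.
    by apply/mP; exact: malpha.
  - by move=> w; rewrite divr_ge0 ?ltW// ?mulr_gt0// gam_gt0.
  - by move=> w; rewrite mulr_ge0 ?ltW.
  - exact: mWT.
  - by move=> w; exact: W0.
  - by move=> w; exact: W0.
  - apply/integrableP; split; first by apply/measurable_EFinP; exact: mWT.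
    under eq_integral do rewrite /= ger0_norm ?W0//.
    by apply: le_lt_trans (ih tT') _; rewrite ltry.
  (* The gradient step cannot go below [f thstar], so [|g1|^2 / (2 Lhat)] is at most
     [f (thtil t w) - f thstar]. *)
  - move=> w; have := descent_step sf LLh Lh0 (g1E w).
    have := fmin (thtil t w - Lhat^-1 *: g1 w); rewrite sqr_norm2 => h1 h2.
    rewrite (_ : c w * _ = gamma0 / gam t.+1 w * (dotv (g1 w) (g1 w) / (2 * Lhat))); last first.
      by rewrite /c; field; rewrite !gt_eqF// gam_gt0.
    by apply: ler_wpM2l; [rewrite mulr_ge0// ltW | lra].
  - move=> w; have [a01 a2] := al w.
    have := @potential_step _ _ _ _ _ thstar cf sf LLh Lh0 gamma0 (zeta t w) (alpha t w)
      (gam t w) (theta t w) (m t w) (g1 w) (g2 t w) g00 (gam_gt0 _ tT' w) a01 a2.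
    rewrite -til => /(_ (g1E w)).
    by rewrite /W /c !sqr_norm2 thS mS gamS.
(* The increments from [inv_sqrt_growth] telescope, starting from the ratio 1 at time 0. *)
have root_gam w t : (t <= T)%N -> 1 + Num.sqrt gamma0 / 2 * \sum_(k < t) Num.sqrt (zeta k w) <=
    Num.sqrt gamma0 / Num.sqrt (gam t w).
  elim: t => [_|t ih tT].
    by rewrite big_ord0 mulr0 addr0 gam0 divff// gt_eqF// sqrtr_gt0.
  have [z0 [_ [al [_ [gamS _]]]]] := algo t tT; have [a01 a2] := al w.
  have := inv_sqrt_growth (gam_gt0 _ (ltnW tT) w) (z0 w) a01 a2.
  rewrite -gamS => /(ler_wpM2l (sqrtr_ge0 gamma0)); have := ih (ltnW tT).
  rewrite big_ord_recr/=; lra.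
apply: le_trans (EW T (leqnn T)); apply: ge0_le_integral => //.
- by move=> w _; rewrite lee_fin mulr_ge0 ?subr_ge0// sqr_ge0.
- apply/measurable_EFinP; apply: measurable_funM.
    apply: measurable_funB => //; apply: measurable_comp_rV => // i.
    by apply: meas_wrt_measurable (filt T).2.1 _; have [_ []] := meas T (leqnn T).
  apply: measurable_funX; apply: measurable_funD => //; apply: measurable_funM => //.
  apply: measurable_sum => k; apply: (measurableT_comp measurable_sqrtr).
  have [_ [mz _]] := algo k (ltn_ord k).
  exact: meas_wrt_measurable (filt k).2.1 mz.
- by apply/measurable_EFinP; exact: mWT.
(* Pointwise, the squared factor is at most [gamma0 / gam T w], and the distance term of the
   potential is dropped. *)
move=> w _; rewrite lee_fin; apply: (@le_trans _ _ (gamma0 / gam T w * (f (theta T w) - f thstar))).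
  rewrite mulrC ler_wpM2r ?subr_ge0//.
  rewrite (_ : gamma0 / gam T w = (Num.sqrt gamma0 / Num.sqrt (gam T w)) ^+ 2); last first.
    by rewrite expr_div_n !sqr_sqrtr// ltW// gam_gt0.
  rewrite ler_pXn2r// ?nnegrE ?root_gam// ?divr_ge0 ?sqrtr_ge0//.
  rewrite addr_ge0// mulr_ge0 ?divr_ge0 ?sqrtr_ge0//.
  by apply: sumr_ge0 => k _; exact: sqrtr_ge0.
by rewrite lerDl mulr_ge0 ?dotvv_ge0// divr_ge0// ltW.
Qed.
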